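(* Let $*$ be a continuous t-norm on $[0,1]$ and let $\varphi\in\Delta$ be a distance distribution. Then $\xi\in\Delta$ is a diagonal on $\varphi$ in the quantale $\Delta_*=(\Delta,\otimes_*,\kappa_{0,1})$ if, and only if, $$\xi(t)=\bigvee_{s<t}\ \bigwedge_{q>0}\varphi(t-s)*\big(\varphi(q)\to_*\xi(q+s)\big)$$ for all $t\in[0,\infty)$.
   Context: A continuous t-norm $*$ is a continuous, associative, commutative binary operation on $[0,1]$, monotone in each variable, with unit $1$. Its implication is $a\to_* b=\bigvee\{c\in[0,1]\mid a*c\leq b\}$, so that $a*c\leq b\iff c\leq a\to_* b$. A distance distribution is a map $\varphi:[0,\infty]\to[0,1]$ with $\varphi(t)=\bigvee_{s<t}\varphi(s)$ for all $t\in[0,\infty]$ (the usual order on $[0,\infty]$; the empty join in $[0,1]$ is $0$, so $\varphi(0)=0$). $\Delta$ is the complete lattice of all distance distributions with the pointwise order: $\varphi\leq\psi$ iff $\varphi(t)\leq\psi(t)$ for all $t\in[0,\infty]$. The convolution of $\varphi,\psi\in\Delta$ is $(\varphi\otimes_*\psi)(t)=\bigvee_{r+s=t}\varphi(r)*\psi(s)$ for $t\in[0,\infty]$ ($r,s\in[0,\infty]$, with $p+\infty=\infty+p=\infty$). Let $\kappa_{0,1}\in\Delta$ be given by $\kappa_{0,1}(0)=0$ and $\kappa_{0,1}(t)=1$ for $t>0$. Then $\Delta_*=(\Delta,\otimes_*,\kappa_{0,1})$ is a commutative and integral quantale (i.e., $\otimes_*$ is a commutative associative operation preserving arbitrary suprema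 in each variable, whose unit $\kappa_{0,1}$ is the top element). Its implication $\Rightarrow_*$ is determined by $\varphi\otimes_*\psi\leq\xi\iff\psi\leq\varphi\Rightarrow_*\xi$. $\xi\in\Delta$ is a diagonal on $\varphi$ in $\Delta_*$ if $\varphi\otimes_*(\varphi\Rightarrow_*\xi)=\xi$; equivalently, there exists $\psi\in\Delta$ with $\varphi\otimes_*\psi=\xi$. In the formula, $s$ ranges over $[0,t)$ and $q$ over $(0,\infty]$. *)

(* Defs.v *)
From mathcomp Require Import all_boot all_order all_algebra.
From mathcomp Require Import all_classical all_reals all_analysis.

Set Implicit Arguments.
Unset Strict Implicit.
Unset Printing Implicit Defensive.

Import Order.TTheory GRing.Theory Num.Theory.
Import numFieldNormedType.Exports.

Local Open Scope classical_set_scope.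
Local Open Scope ring_scope.

(* Conventions.  The lattice [0,1] is the interval `[0, 1] of R.  Since
   [sup set0 = 0] in R, [sup] of a subset of `[0, 1] is its join in [0,1],
   including the empty join.  On the other hand [inf set0 = 0], so [inf] is
   the meet in [0,1] of nonempty subsets of `[0, 1] only.
   The half-line [0,oo] is the set of nonnegative elements of \bar R: a
   function on [0,oo] is represented by a function on \bar R whose values at
   negative arguments are irrelevant, and two such functions are identified
   when they agree at all nonnegative arguments. *)

Record continuous_tnorm (R : realType) (T : R -> R -> R) : Prop :=
  ContinuousTnorm {
    tnorm_closed : {in `[0, 1] &, forall x y : R, T x y \in `[0, 1]};
    tnorm_continuous :
      {within [set p : R * R | p.1 \in `[0, 1] /\ p.2 \in `[0, 1]],
        continuous (fun p : R * R => T p.1 p.2)};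
    tnormA : {in `[0, 1] & &, associative T};
    tnormC : {in `[0, 1] &, commutative T};
    tnorm_monol : {in `[0, 1] & &,
      forall x y z : R, x <= y -> T x z <= T y z};
    tnorm_monor : {in `[0, 1] & &,
      forall x y z : R, x <= y -> T z x <= T z y};
    tnorm1x : {in `[0, 1], left_id 1 T};
    tnormx1 : {in `[0, 1], right_id 1 T} }.

Definition tnorm_impl (R : realType) (T : R -> R -> R) (a b : R) : R :=
  sup [set c | c \in `[0, 1] /\ T a c <= b].

Record distance_distribution (R : realType) (phi : \bar R -> R) : Prop :=
  DistanceDistribution {
    ddist_itv01 : forall t : \bar R, (0 <= t)%E -> phi t \in `[0, 1];
    ddist_sup : forall t : \bar R, (0 <= t)%E ->
      phi t = sup [set phi s | s in [set s : \bar R | (0 <= s < t)%E]] }.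

Definition ddist_le (R : realType) (phi psi : \bar R -> R) : Prop :=
  forall t : \bar R, (0 <= t)%E -> phi t <= psi t.

Definition ddist_eq (R : realType) (phi psi : \bar R -> R) : Prop :=
  forall t : \bar R, (0 <= t)%E -> phi t = psi t.

Definition ddist_conv (R : realType) (T : R -> R -> R)
    (phi psi : \bar R -> R) (t : \bar R) : R :=
  sup [set T (phi p.1) (psi p.2) | p in [set p : \bar R * \bar R |
    [/\ (0 <= p.1)%E, (0 <= p.2)%E & (p.1 + p.2)%E = t]]].

(* The residual of the quantale of distance distributions: the join of all
   distance distributions psi with phi (x) psi <= xi.  Joins of distance
   distributions are pointwise. *)
Definition ddist_impl (R : realType) (T : R -> R -> R)
    (phi xi : \bar R -> R) (t : \bar R) : R :=
  sup [set psi t | psi in [set psi : \bar R -> R |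
    distance_distribution psi /\ ddist_le (ddist_conv T phi psi) xi]].

Definition ddist_diagonal (R : realType) (T : R -> R -> R)
    (phi xi : \bar R -> R) : Prop :=
  ddist_eq (ddist_conv T phi (ddist_impl T phi xi)) xi.

(* Main.v *)
Require Import Defs.
From mathcomp Require Import all_boot all_order all_algebra.
From mathcomp Require Import all_classical all_reals all_analysis.
From mathcomp Require Import lra.

(** The theorem becomes transparent once the residual [phi => xi] is known
    explicitly.  A distance distribution [psi] satisfies [phi (x) psi <= xi]
    exactly when [phi q * psi s <= xi (q + s)] for all [q] and [s].  The
    instances with [q = 0] are trivial because [phi 0 = 0]; by residuation in
    [0,1] the others say that [psi <= g], where
      [g s = /\_(q > 0) (phi q -> xi (q + s))]
    ([residual_bound], [residual_boundP]).  The function [g] increases but need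
    not be left continuous, so the greatest distance distribution below it is
    [t |-> \/_(s < t) g s] ([left_reg]), and this is [phi => xi]
    ([ddist_implE]).

    At a finite time [t] the convolution [phi (x) (phi => xi)] is then
    [\/_(s < t) phi (t - s) * g s] ([conv_residualE]): passing from [g] to its
    regularization costs an arbitrarily small amount of time, which the left
    continuity of [phi] gives back.  A continuous t-norm preserves nonempty
    meets ([tnorm_inf]), so the product with [phi (t - s)] may be moved inside
    the meet that defines [g s]; this turns the convolution into the formula of
    the theorem.  The formula is thus the equation of diagonality at finite
    times.  The equation at [+oo] follows from these, since [xi] is left
    continuous at [+oo], the convolution is bounded by [xi], and pairs summing
    to a finite [t] are dominated by pairs summing to [+oo]. *)

Set Implicit Arguments.
Unset Strict Implicit.
Unset Printing Implicit Defensive.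

Import Order.TTheory GRing.Theory Num.Theory.
Import numFieldNormedType.Exports.

Local Open Scope classical_set_scope.
Local Open Scope ring_scope.

(** * Joins and meets in the unit interval *)

Section UnitInterval.
Variable R : realType.
Implicit Types (A : set R) (b x : R).

(** The bound must be nonnegative because the empty join is [0]. *)
Lemma unit_sup_le A b : 0 <= b -> (forall x, A x -> x <= b) -> sup A <= b.
Proof.
move=> b0 Ab; have [->|/set0P A0] := eqVneq A set0; first by rewrite sup0.
by apply: ge_sup => // x /Ab.
Qed.

Lemma le_unit_sup A x : A `<=` `[0, 1] -> A x -> x <= sup A.
Proof.
move=> A01 Ax; apply: ub_le_sup => //; exists 1 => y /A01 /=.
by rewrite in_itv /= => /andP[].
Qed.

Lemma unit_sup_ge0 A : A `<=` `[0, 1] -> 0 <= sup A.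
Proof.
move=> A01; have [->|/set0P[x Ax]] := eqVneq A set0; first by rewrite sup0.
apply: le_trans (le_unit_sup A01 Ax).
by have := A01 _ Ax; rewrite /= in_itv /= => /andP[].
Qed.

Lemma unit_sup_itv A : A `<=` `[0, 1] -> sup A \in `[0, 1].
Proof.
move=> A01; rewrite in_itv /= unit_sup_ge0 //=; apply: unit_sup_le => // x /A01.
by rewrite /= in_itv /= => /andP[].
Qed.

Lemma unit_inf_le A x : A `<=` `[0, 1] -> A x -> inf A <= x.
Proof.
move=> A01 Ax; apply: ge_inf => //; exists 0 => y /A01 /=.
by rewrite in_itv /= => /andP[].
Qed.

Lemma unit_inf_itv A : A !=set0 -> A `<=` `[0, 1] -> inf A \in `[0, 1].
Proof.
move=> A0 A01; rewrite in_itv /=; apply/andP; split.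
  by apply: lb_le_inf => // x /A01; rewrite /= in_itv /= => /andP[].
have [x Ax] := A0; apply: le_trans (unit_inf_le A01 Ax) _.
by have := A01 _ Ax; rewrite /= in_itv /= => /andP[].
Qed.

Lemma closure_inf A : A !=set0 -> has_lbound A -> closure A (inf A).
Proof.
move=> A0 lA B /nbhs_ballP[e /= e0 eB].
have [x Ax xe] := inf_adherent e0 (conj A0 lA).
exists x; split=> //; apply: eB; rewrite /ball /= distrC ger0_norm.
  by rewrite ltrBlDl.
by rewrite subr_ge0; apply: ge_inf.
Qed.

End UnitInterval.

(** * Continuous t-norms *)

Section Tnorm.
Variables (R : realType) (T : R -> R -> R).
Hypothesis hT : continuous_tnorm T.
Implicit Types (A C : set R) (a b c x : R).

Let zero01 : (0 : R) \in `[0, 1].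
Proof. by rewrite in_itv /= lexx ler01. Qed.
Let one01 : (1 : R) \in `[0, 1].
Proof. by rewrite in_itv /= lexx ler01. Qed.
Let ge0_01 x : x \in `[0, 1] -> 0 <= x.
Proof. by rewrite in_itv /= => /andP[]. Qed.
Let le1_01 x : x \in `[0, 1] -> x <= 1.
Proof. by rewrite in_itv /= => /andP[]. Qed.

Lemma tnorm_le a b c d : a \in `[0, 1] -> b \in `[0, 1] -> c \in `[0, 1] ->
  d \in `[0, 1] -> a <= c -> b <= d -> T a b <= T c d.
Proof.
move=> a1 b1 c1 d1 ac bd; apply: le_trans (tnorm_monol hT a1 c1 b1 ac) _.
exact: (tnorm_monor hT b1 d1 c1 bd).
Qed.

Lemma tnormx0 a : a \in `[0, 1] -> T a 0 = 0.
Proof.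
move=> a1; apply/le_anti/andP; split; last exact/ge0_01/(tnorm_closed hT).
by rewrite -[leRHS](tnorm1x hT zero01); apply: tnorm_le => //; exact: le1_01.
Qed.

Lemma tnorm0x a : a \in `[0, 1] -> T 0 a = 0.
Proof. by move=> a1; rewrite (tnormC hT) // tnormx0. Qed.

(** This is the only use of continuity: preservation of joins and of meets both
    come from it, since a join or a meet of a nonempty set adheres to it. *)
Lemma tnorm_closure A C a c : a \in `[0, 1] -> A `<=` `[0, 1] ->
  c \in `[0, 1] -> closure A c -> closed C -> (forall x, A x -> C (T a x)) ->
  C (T a c).
Proof.
move=> a1 A01 c1 cA cC AC; rewrite (closure_id C).1 // => B nB.
have /subspace_continuousP/(_ (a, c) (conj a1 c1) B nB) := tnorm_continuous hT.
rewrite /= => -[[U V] /= [Ua Vc] UV].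
have [x [Ax Vx]] := cA _ Vc; exists (T a x); split; first exact: AC.
apply: (UV (a, x)); last by split=> //=; exact: A01.
by split=> //=; exact: nbhs_singleton.
Qed.

Lemma tnorm_sup_le A a b : a \in `[0, 1] -> A `<=` `[0, 1] -> 0 <= b ->
  (forall x, A x -> T a x <= b) -> T a (sup A) <= b.
Proof.
move=> a1 A01 b0 Ab.
have [->|/set0P A0] := eqVneq A set0; first by rewrite sup0 tnormx0.
apply: (tnorm_closure (C := [set y | y <= b]) a1 A01) => //.
- exact: unit_sup_itv.
- apply: closure_sup => //; exists 1 => x /A01; exact: le1_01.
Qed.

Lemma tnorm_inf A a : a \in `[0, 1] -> A !=set0 -> A `<=` `[0, 1] ->
  T a (inf A) = inf [set T a x | x in A].
Proof.
move=> a1 A0 A01; have I01 := unit_inf_itv A0 A01.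
have TA01 : [set T a x | x in A] `<=` `[0, 1].
  by move=> _ [x /A01 x1 <-]; exact: (tnorm_closed hT).
apply/le_anti/andP; split.
  apply: lb_le_inf => [|_ [x Ax <-]]; first by have [x] := A0; exists (T a x), x.
  by apply: tnorm_le => //; [exact: A01|exact: unit_inf_le].
apply: (tnorm_closure (C := [set y | inf [set T a x | x in A] <= y]) a1 A01) => //.
- apply: closure_inf => //; exists 0 => x /A01; exact: ge0_01.
- by move=> x Ax; apply: unit_inf_le => //; exists x.
Qed.

Lemma tnorm_impl_itv a b : tnorm_impl T a b \in `[0, 1].
Proof. by apply: unit_sup_itv => c []. Qed.

Lemma tnorm_residuation a b c : a \in `[0, 1] -> b \in `[0, 1] ->
  c \in `[0, 1] -> (T a c <= b) = (c <= tnorm_impl T a b).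
Proof.
move=> a1 b1 c1; apply/idP/idP => [Tb|cab].
  by apply: le_unit_sup => // x [].
apply: le_trans (tnorm_le a1 c1 a1 (tnorm_impl_itv a b) (lexx a) cab) _.
by apply: tnorm_sup_le => // [x []||x []] //; exact: ge0_01.
Qed.

End Tnorm.

(** * Distance distributions *)

Section Ddist.
Variable R : realType.
Implicit Types (phi g : \bar R -> R) (s t : \bar R).

Lemma ereal_dense s t : (0 <= s)%E -> (s < t)%E ->
  exists r : \bar R, (s < r < t)%E.
Proof.
case: s => [s| |] //=; case: t => [t| |] //= _.
  by rewrite lte_fin => st; exists ((s + t) / 2)%:E; rewrite !lte_fin; lra.
by move=> _; exists (s + 1)%:E; rewrite lte_fin ltry ltrDl ltr01.
Qed.

Lemma ddist_image_itv phi (P : set (\bar R)) : distance_distribution phi ->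
  P `<=` [set t | (0 <= t)%E] -> phi @` P `<=` `[0, 1].
Proof. by move=> hphi P0 _ [t /P0 t0 <-]; exact: ddist_itv01. Qed.

Lemma ddist0 phi : distance_distribution phi -> phi 0%E = 0.
Proof.
move=> hphi; rewrite (ddist_sup hphi (lexx _)).
rewrite (_ : [set s | _] = set0) ?image_set0 ?sup0 //.
by apply/seteqP; split=> // s /= /andP[s0 /(le_lt_trans s0)]; rewrite ltxx.
Qed.

Lemma ddist_mono phi s t : distance_distribution phi -> (0 <= s)%E ->
  (s <= t)%E -> phi s <= phi t.
Proof.
move=> hphi s0; rewrite le_eqVlt => /predU1P[-> //|st].
rewrite (ddist_sup hphi (le_trans s0 (ltW st))).
apply: le_unit_sup; last by exists s => //=; rewrite s0 st.
by apply: ddist_image_itv => // r /= /andP[].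
Qed.

(** For an increasing [g] with values in [0,1] this is the greatest distance
    distribution below [g]. *)
Definition left_reg g (t : \bar R) : R :=
  sup [set g s | s in [set s : \bar R | (0 <= s < t)%E]].

Section LeftReg.
Variable g : \bar R -> R.
Hypothesis g01 : forall s, (0 <= s)%E -> g s \in `[0, 1].

Let left_set_itv t : [set g s | s in [set s : \bar R | (0 <= s < t)%E]] `<=` `[0, 1].
Proof. by move=> _ [s /= /andP[s0 _] <-]; exact: g01. Qed.

Lemma left_reg_itv t : left_reg g t \in `[0, 1].
Proof. exact: unit_sup_itv. Qed.

Lemma le_left_reg s t : (0 <= s)%E -> (s < t)%E -> g s <= left_reg g t.
Proof.
by move=> s0 st; apply: le_unit_sup => //; exists s => //=; rewrite s0 st.
Qed.

Lemma left_reg_ddist : distance_distribution (left_reg g).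
Proof.
split=> [t _|t t0]; first exact: left_reg_itv.
have L01 : [set left_reg g s | s in [set s | (0 <= s < t)%E]] `<=` `[0, 1].
  by move=> _ [s _ <-]; exact: left_reg_itv.
apply/le_anti/andP; split; apply: unit_sup_le; rewrite ?unit_sup_ge0 //.
  move=> _ [s /= /andP[s0 st] <-].
  have [r /andP[sr rt]] := ereal_dense s0 st.
  apply: le_trans (le_left_reg s0 sr) _; apply: le_unit_sup => //.
  by exists r => //=; rewrite rt (le_trans s0 (ltW sr)).
move=> _ [s /= /andP[s0 st] <-]; apply: unit_sup_le; first exact: unit_sup_ge0.
by move=> _ [r /= /andP[r0 rs] <-]; apply: le_left_reg => //; exact: lt_trans st.
Qed.

Lemma left_reg_le t : (0 <= t)%E ->
  (forall s, (0 <= s)%E -> (s <= t)%E -> g s <= g t) -> left_reg g t <= g t.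
Proof.
move=> t0 mono; apply: unit_sup_le.
  by have := g01 t0; rewrite in_itv /= => /andP[].
by move=> _ [s /= /andP[s0 st] <-]; apply: mono => //; exact: ltW.
Qed.

End LeftReg.
End Ddist.

(** * The residual and its convolution *)

Section Residual.
Variables (R : realType) (T : R -> R -> R) (phi xi : \bar R -> R).
Hypotheses (hT : continuous_tnorm T) (hphi : distance_distribution phi).
Hypothesis hxi : distance_distribution xi.
Implicit Types (s t q : \bar R) (x : R).

Let ge0_01 x : x \in `[0, 1] -> 0 <= x.
Proof. by rewrite in_itv /= => /andP[]. Qed.

Definition residual_bound s : R :=
  inf [set tnorm_impl T (phi q) (xi (q + s)%E) | q in [set q | (0 < q)%E]].

Let g := residual_bound.

Let bound_set_itv s :
  [set tnorm_impl T (phi q) (xi (q + s)%E) | q in [set q | (0 < q)%E]] `<=` `[0, 1].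
Proof. by move=> _ [q _ <-]; exact: tnorm_impl_itv. Qed.

Let bound_set_neq0 s :
  [set tnorm_impl T (phi q) (xi (q + s)%E) | q in [set q | (0 < q)%E]] !=set0.
Proof.
by exists (tnorm_impl T (phi +oo%E) (xi (+oo + s)%E)); exists +oo%E => //=; exact: ltry.
Qed.

Lemma residual_bound_itv s : g s \in `[0, 1].
Proof. exact: unit_inf_itv. Qed.

Lemma residual_boundP s x : (0 <= s)%E -> x \in `[0, 1] ->
  (forall q, (0 <= q)%E -> T (phi q) x <= xi (q + s)%E) <-> x <= g s.
Proof.
move=> s0 x1; split=> [H|xg q].
  apply: lb_le_inf => // _ [q /= q0 <-].
  rewrite -tnorm_residuation // ?H ?(ltW q0) //.
    by apply: (ddist_itv01 hphi); exact: ltW.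
  by apply: (ddist_itv01 hxi); rewrite adde_ge0 // ltW.
rewrite le_eqVlt => /predU1P[<-|q0].
  by rewrite (ddist0 hphi) (tnorm0x hT) // ge0_01 // (ddist_itv01 hxi) // add0e.
have q0' := ltW q0.
rewrite tnorm_residuation //.
- by apply: le_trans xg _; apply: unit_inf_le => //; exists q.
- exact: (ddist_itv01 hphi).
- by apply: (ddist_itv01 hxi); rewrite adde_ge0.
Qed.

Lemma tnorm_residual_bound q s : (0 <= q)%E -> (0 <= s)%E ->
  T (phi q) (g s) <= xi (q + s)%E.
Proof.
move=> q0 s0; move: q q0; apply/residual_boundP => //; exact: residual_bound_itv.
Qed.

Lemma residual_bound_mono s t : (0 <= s)%E -> (s <= t)%E -> g s <= g t.
Proof.
move=> s0 st; have t0 := le_trans s0 st.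
apply/residual_boundP => //; first exact: residual_bound_itv.
move=> q q0; apply: le_trans (tnorm_residual_bound q0 s0) _.
by apply: ddist_mono => //; [rewrite adde_ge0|exact: leeD2l].
Qed.

Let g01 s (_ : (0 <= s)%E) : g s \in `[0, 1] := residual_bound_itv s.

Let conv_set_itv (psi : \bar R -> R) t : distance_distribution psi ->
  [set T (phi p.1) (psi p.2) | p in [set p : \bar R * \bar R |
    [/\ (0 <= p.1)%E, (0 <= p.2)%E & (p.1 + p.2)%E = t]]] `<=` `[0, 1].
Proof.
move=> hpsi _ [[q s] /= [q0 s0 _] <-].
by apply: (tnorm_closed hT); [exact: (ddist_itv01 hphi)|exact: (ddist_itv01 hpsi)].
Qed.

Lemma le_ddist_conv (psi : \bar R -> R) q s : distance_distribution psi ->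
  (0 <= q)%E -> (0 <= s)%E -> T (phi q) (psi s) <= ddist_conv T phi psi (q + s)%E.
Proof.
move=> hpsi q0 s0; apply: le_unit_sup; first exact: conv_set_itv.
by exists (q, s).
Qed.

Lemma conv_left_reg_le : ddist_le (ddist_conv T phi (left_reg g)) xi.
Proof.
move=> t t0; apply: unit_sup_le; first exact/ge0_01/(ddist_itv01 hxi).
move=> _ [[q s] /= [q0 s0 <-] <-].
apply: le_trans (tnorm_residual_bound q0 s0).
apply: tnorm_le => //.
- exact: (ddist_itv01 hphi).
- exact: left_reg_itv.
- exact: (ddist_itv01 hphi).
- exact: residual_bound_itv.
- by apply: left_reg_le => // r r0 rs; exact: residual_bound_mono.
Qed.

Lemma ddist_implE t : (0 <= t)%E -> ddist_impl T phi xi t = left_reg g t.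
Proof.
move=> t0; apply/le_anti/andP; split; last first.
  apply: le_unit_sup => [_ [psi [hpsi _] <-]|].
    exact: (ddist_itv01 hpsi).
  exists (left_reg g) => //; split; first exact: left_reg_ddist.
  exact: conv_left_reg_le.
apply: unit_sup_le; first exact/ge0_01/left_reg_itv.
move=> _ [psi [hpsi le_xi] <-]; rewrite (ddist_sup hpsi t0).
apply: unit_sup_le; first exact/ge0_01/left_reg_itv.
move=> _ [s /= /andP[s0 st] <-]; apply: le_trans (le_left_reg g01 s0 st).
apply/residual_boundP => //; first exact: (ddist_itv01 hpsi).
move=> q q0; apply: le_trans (le_ddist_conv hpsi q0 s0) _.
by apply: le_xi; rewrite adde_ge0.
Qed.

Lemma ddist_conv_implE t :
  ddist_conv T phi (ddist_impl T phi xi) t = ddist_conv T phi (left_reg g) t.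
Proof.
congr sup; apply/seteqP; split=> _ [[q s] /= [q0 s0 qs] <-].
  by exists (q, s) => //=; rewrite ddist_implE.
by exists (q, s) => //=; rewrite ddist_implE.
Qed.

(** The upper bound uses [left_reg g <= g], the split [(0, t)] contributing
    nothing.  For the lower bound, [phi (t - s)] is the join of the [phi r] with
    [r < t - s], and since [s < t - r] there is room for [g s <= left_reg g (t - r)]. *)
Lemma conv_residualE (t : R) : 0 <= t ->
  ddist_conv T phi (ddist_impl T phi xi) t%:E =
  sup [set T (phi (t - s)%:E) (g s%:E) | s in [set s : R | 0 <= s < t]].
Proof.
move=> t0; rewrite ddist_conv_implE; have hL := left_reg_ddist g01.
have S01 : [set T (phi (t - s)%:E) (g s%:E) | s in [set s : R | 0 <= s < t]]
    `<=` `[0, 1].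
  move=> _ [s /= /andP[s0 st] <-]; apply: (tnorm_closed hT).
    by apply: (ddist_itv01 hphi); rewrite lee_fin subr_ge0 ltW.
  exact: residual_bound_itv.
apply/le_anti/andP; split; apply: unit_sup_le.
- exact: unit_sup_ge0.
- move=> _ [[q s] /= [q0 s0 qs] <-].
  move: q0; rewrite le_eqVlt => /predU1P[<-|q0].
    rewrite (ddist0 hphi) (tnorm0x hT) ?unit_sup_ge0 //; exact: left_reg_itv.
  case: q q0 qs => [q| |] //; case: s s0 => [s| |] // s0 q0 [qs].
  rewrite !lee_fin !lte_fin in s0 q0; rewrite -qs in S01 *.
  apply: (@le_trans _ _ (T (phi q%:E) (g s%:E))).
    apply: tnorm_le => //.
    + by apply: (ddist_itv01 hphi); rewrite lee_fin ltW.
    + exact: left_reg_itv.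
    + by apply: (ddist_itv01 hphi); rewrite lee_fin ltW.
    + exact: residual_bound_itv.
    + by apply: left_reg_le => // r r0 rs; exact: residual_bound_mono.
  apply: le_unit_sup => //; exists s; last by rewrite addrK.
  by rewrite /= s0 ltrDr.
- exact/unit_sup_ge0/conv_set_itv.
- move=> _ [s /= /andP[s0 st] <-].
  have ts0 : (0 <= (t - s)%:E)%E by rewrite lee_fin subr_ge0 ltW.
  have gs1 := residual_bound_itv s%:E.
  rewrite (tnormC hT) //; last exact: (ddist_itv01 hphi).
  rewrite (ddist_sup hphi ts0); apply: tnorm_sup_le => //.
  + by apply: ddist_image_itv => // r /= /andP[].
  + exact/unit_sup_ge0/conv_set_itv.
  move=> _ [[r| |] //= /andP[r0 rts] <-]; last by rewrite ltNge leey in rts.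
  rewrite !lee_fin !lte_fin in r0 rts.
  rewrite (tnormC hT) //; last by apply: (ddist_itv01 hphi); rewrite lee_fin.
  apply: (@le_trans _ _ (T (phi r%:E) (left_reg g (t - r)%:E))).
    apply: tnorm_le => //; try by apply: (ddist_itv01 hphi); rewrite lee_fin.
      exact: left_reg_itv.
    by apply: le_left_reg => //; rewrite ?lee_fin ?lte_fin //; lra.
  have -> : t%:E = (r%:E + (t - r)%:E)%E by rewrite -EFinD addrC subrK.
  by apply: le_ddist_conv => //; rewrite lee_fin; lra.
Qed.

(** At [+oo]: [xi] is the join of its finite values [xi t], and each splitting
    [q + s = t] may be replaced by the splitting [+oo + s = +oo]. *)
Lemma ddist_diagonal_finite :
  (forall t : R, 0 <= t ->
    ddist_conv T phi (ddist_impl T phi xi) t%:E = xi t%:E) ->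
  ddist_diagonal T phi xi.
Proof.
move=> fin [t| |] // t0; first by apply: fin; rewrite -lee_fin.
rewrite ddist_conv_implE; have hL := left_reg_ddist g01.
have C0 : 0 <= ddist_conv T phi (left_reg g) +oo%E.
  exact/unit_sup_ge0/conv_set_itv.
apply/le_anti/andP; split; first exact: conv_left_reg_le.
rewrite (ddist_sup hxi t0); apply: unit_sup_le => //.
move=> _ [[s| |] //= /andP[s0 soo] <-]; last by rewrite ltxx in soo.
rewrite lee_fin in s0; rewrite -fin // ddist_conv_implE.
apply: unit_sup_le => // _ [[q r] /= [q0 r0 _] <-].
have <- : (+oo + r = +oo)%E by case: r r0.
apply: le_trans (le_ddist_conv hL (leey 0%E) r0).
apply: tnorm_le => //; try exact: (ddist_itv01 hphi); try exact: left_reg_itv.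
by apply: ddist_mono => //; exact: leey.
Qed.

Lemma tnorm_residual_boundE a s : a \in `[0, 1] ->
  T a (g s) = inf [set T a (tnorm_impl T (phi q) (xi (q + s)%E))
                  | q in [set q | (0 < q)%E]].
Proof. by move=> a1; rewrite tnorm_inf // image_comp. Qed.

End Residual.

Theorem theorem4p6 (R : realType) (T : R -> R -> R) (phi xi : \bar R -> R) :
  continuous_tnorm T ->
  distance_distribution phi ->
  distance_distribution xi ->
  ddist_diagonal T phi xi <->
  (forall t : R, 0 <= t ->
    xi t%:E =
    sup [set inf [set T (phi (t - s)%:E)
                        (tnorm_impl T (phi q) (xi (q + s%:E)%E))
                 | q in [set q : \bar R | (0 < q)%E]]
        | s in [set s : R | 0 <= s < t]]).
Proof.
move=> hT hphi hxi.
have convE (t : R) : 0 <= t -> ddist_conv T phi (ddist_impl T phi xi) t%:E =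
    sup [set inf [set T (phi (t - s)%:E)
                        (tnorm_impl T (phi q) (xi (q + s%:E)%E))
                 | q in [set q : \bar R | (0 < q)%E]]
        | s in [set s : R | 0 <= s < t]].
  move=> t0; rewrite conv_residualE //; congr sup; apply: eq_imagel => s /=.
  move=> /andP[_ st]; apply: tnorm_residual_boundE => //.
  by apply: (ddist_itv01 hphi); rewrite lee_fin subr_ge0 ltW.
split=> [diag t t0|formula]; first by rewrite -convE // diag // lee_fin.
by apply: ddist_diagonal_finite => // t t0; rewrite convE // -formula.
Qed.
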